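(* Let $(X_i,d_i)_i$ be a complex of vector spaces and linear operators $d_i:X_i\to X_{i+1}$, let $(\hat X_i)_i$ be a second sequence of vector spaces, and let $E_i:\hat X_i\to X_i$ (extensions) and $\hat R_i:X_i\to\hat X_i$ (reductions) be linear maps. Set $\hat d_i:=\hat R_{i+1}d_iE_i:\hat X_i\to\hat X_{i+1}$. Assume that, for all $i$: (C1) $(\hat R_iE_i)_{|\ker\hat d_i}=\mathrm{Id}_{\ker\hat d_i}$; (C2) $(E_{i+1}\hat R_{i+1}-\mathrm{Id}_{X_{i+1}})(\ker d_{i+1})\subset\operatorname{Im}d_i$; (C3) $\hat R_{i+1}d_i=\hat d_i\hat R_i$ and $E_{i+1}\hat d_i=d_iE_i$. Then the sequence $(\hat X_i,\hat d_i)_i$ is a complex, and the cohomologies of $(X_i,d_i)_i$ and $(\hat X_i,\hat d_i)_i$ are isomorphic. In particular, if one complex is exact then so is the other.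
   Context: A sequence $(X_i,d_i)_i$ is a complex if $d_{i+1}d_i=0$ for all $i$. Its cohomology spaces are $\ker d_i/\operatorname{Im}d_{i-1}$. Two complexes have isomorphic cohomologies if, for every $i$, their $i$-th cohomology spaces are isomorphic as vector spaces. A complex is exact if all its cohomology spaces are trivial. *)

(* Defs.v *)
From HB Require Import structures.
From mathcomp Require Import all_boot all_algebra.
From mathcomp Require Import boolp.

Set Implicit Arguments.
Unset Strict Implicit.
Unset Printing Implicit Defensive.

Import GRing.Theory.
Local Open Scope ring_scope.
Local Open Scope quotient_scope.

Section Kernel.
Context (K : fieldType) (U V : lmodType K) (f : {linear U -> V}).

Definition in_ker : {pred U} := fun x => f x == 0.

Lemma in_ker_submod : submod_closed in_ker.
Proof.
split=> [|a x y]; rewrite !unfold_in /in_ker ?raddf0 //.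
by move=> /eqP fx /eqP fy; rewrite linearP fx fy scaler0 addr0.
Qed.

HB.instance Definition _ := GRing.isSubmodClosed.Build K U in_ker in_ker_submod.

Record ker := Ker { ker_val : U; ker_valP : in_ker ker_val }.

HB.instance Definition _ := [isSub for ker_val].
HB.instance Definition _ := [Choice of ker by <:].
HB.instance Definition _ := [SubChoice_isSubLmodule of ker by <:].

End Kernel.

Section Image.
Context (K : fieldType) (U V W : lmodType K).
Context (f : {linear U -> V}) (g : {linear V -> W}).

(* The elements of ker g lying in Im f. When g \o f = 0 this is all of Im f;
   in general it is the intersection of Im f with ker g. *)
Definition im_in_ker : {pred ker g} := fun x => `[< exists y, f y = ker_val x >].

Lemma im_in_ker_submod : submod_closed im_in_ker.
Proof.
split=> [|a x y]; first by apply/asboolP; exists 0; rewrite raddf0.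
move=> /asboolP[x' ex] /asboolP[y' ey]; apply/asboolP.
by exists (a *: x' + y'); rewrite linearP ex ey.
Qed.

HB.instance Definition _ :=
  GRing.isSubmodClosed.Build K (ker g) im_in_ker im_in_ker_submod.

End Image.

Arguments im_in_ker {K U V W} f g.

(* Quotient.quot only provides the quotient of a Z-module by a subgroup. *)
Section QuotientSpace.
Context (K : fieldType) (V : lmodType K) (S : submodClosed V).

(* submodClosed does not record closure under opposites, which Quotient.quot
   asks for; subspace_pred is S equipped with it. *)
Definition subspace_pred : {pred V} := S.

Lemma subspace_pred_submod : submod_closed subspace_pred.
Proof. by split=> [|a x y xS yS]; [apply: rpred0 | rewrite rpredD ?rpredZ]. Qed.

HB.instance Definition _ :=
  GRing.isSubmodClosed.Build K V subspace_pred subspace_pred_submod.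

Definition quot_space : Type := Quotient.quot subspace_pred.

HB.instance Definition _ := Choice.on quot_space.
HB.instance Definition _ := GRing.Zmodule.on quot_space.

Definition quot_proj (x : V) : quot_space := \pi_(Quotient.quot subspace_pred) x.

Definition quot_scale (a : K) (u : quot_space) : quot_space :=
  quot_proj (a *: repr (u : Quotient.quot subspace_pred)).

Lemma quot_projP x y : reflect (quot_proj x = quot_proj y) (x - y \in S).
Proof.
by rewrite -[_ \in S]/(_ \in subspace_pred) Quotient.idealrBE; apply: eqP.
Qed.

Lemma quot_proj_surj (u : quot_space) : exists x, quot_proj x = u.
Proof. by exists (repr (u : Quotient.quot subspace_pred)); rewrite /quot_proj reprK. Qed.

Lemma quot_projD : {morph quot_proj : x y / x + y}.
Proof. by move=> x y; rewrite /quot_proj raddfD. Qed.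

Lemma quot_scaleE a x : quot_scale a (quot_proj x) = quot_proj (a *: x).
Proof.
apply/quot_projP; rewrite -scalerBr rpredZ //.
by apply/quot_projP; rewrite /quot_proj reprK.
Qed.

Lemma quot_scaleA a b u : quot_scale a (quot_scale b u) = quot_scale (a * b) u.
Proof. by have [x <-] := quot_proj_surj u; rewrite !quot_scaleE scalerA. Qed.

Lemma quot_scale1 : left_id 1 quot_scale.
Proof.
by move=> u; have [x <-] := quot_proj_surj u; rewrite quot_scaleE scale1r.
Qed.

Lemma quot_scaleDr : right_distributive quot_scale +%R.
Proof.
move=> a u v; have [x <-] := quot_proj_surj u; have [y <-] := quot_proj_surj v.
by rewrite -quot_projD !quot_scaleE -quot_projD scalerDr.
Qed.

Lemma quot_scaleDl u : {morph quot_scale^~ u : a b / a + b}.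
Proof.
move=> a b; have [x <-] := quot_proj_surj u.
by rewrite !quot_scaleE -quot_projD scalerDl.
Qed.

HB.instance Definition _ := GRing.Zmodule_isLmodule.Build K quot_space
  quot_scaleA quot_scale1 quot_scaleDr quot_scaleDl.

Lemma quot_proj_linear : linear quot_proj.
Proof. by move=> a x y; rewrite quot_projD -quot_scaleE. Qed.

HB.instance Definition _ :=
  GRing.isLinear.Build K V quot_space *:%R quot_proj quot_proj_linear.

End QuotientSpace.

Definition lin_isomorphic (K : fieldType) (U V : lmodType K) : Prop :=
  exists f : {linear U -> V}, bijective f.

Section Complexes.
Context (K : fieldType) (X : int -> lmodType K).
Context (d : forall i, {linear X i -> X (i + 1)}).

Definition is_complex : Prop := forall i x, d (i + 1) (d i x) = 0.

(* d_{i-1} with its codomain X_{(i-1)+1} transported to X_i. *)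
Definition dprev (i : int) : {linear X (i - 1) -> X i} :=
  ecast j {linear X (i - 1) -> X j} (subrK 1 i) (d (i - 1)).

Definition cohomology (i : int) : lmodType K :=
  quot_space (im_in_ker (dprev i) (d i)).

Definition is_exact : Prop := forall i (h : cohomology i), h = 0.

End Complexes.

Definition isomorphic_cohomologies (K : fieldType) (X Y : int -> lmodType K)
    (d : forall i, {linear X i -> X (i + 1)})
    (e : forall i, {linear Y i -> Y (i + 1)}) : Prop :=
  forall i, lin_isomorphic (cohomology d i) (cohomology e i).

Definition dhat (K : fieldType) (X Xh : int -> lmodType K)
    (d : forall i, {linear X i -> X (i + 1)})
    (E : forall i, {linear Xh i -> X i}) (Rh : forall i, {linear X i -> Xh i})
    (i : int) : {linear Xh i -> Xh (i + 1)} :=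
  Rh (i + 1) \o d i \o E i.

(* Main.v *)
(** By (C3), [Rh] and [E] are cochain maps between the two complexes, so they
    induce maps on cohomology. These are mutually inverse: [Rh \o E] is the
    identity on cocycles by (C1), and [E \o Rh] differs from the identity by
    coboundaries on cocycles by (C2). *)

From HB Require Import structures.
Require Import Defs.
From mathcomp Require Import all_boot all_algebra.
From mathcomp Require Import boolp.
Set Implicit Arguments.
Unset Strict Implicit.
Unset Printing Implicit Defensive.

Import GRing.Theory.
Local Open Scope ring_scope.

Section KerMap.
Context (K : fieldType) (V V' W W' : lmodType K).
Context (g : {linear V -> W}) (g' : {linear V' -> W'}) (f : {linear V -> V'}).
Hypothesis fP : forall x, g x = 0 -> g' (f x) = 0.

Lemma ker_valK (x : ker g) : g (ker_val x) = 0.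
Proof. exact/eqP/ker_valP. Qed.

Definition ker_map (x : ker g) : ker g' :=
  Ker (introT eqP (fP (ker_valK x)) : in_ker g' (f (ker_val x))).

Lemma ker_map_linear : linear ker_map.
Proof. by move=> a x y; apply: val_inj; rewrite /= linearP. Qed.

HB.instance Definition _ :=
  GRing.isLinear.Build K (ker g) (ker g') *:%R ker_map ker_map_linear.

End KerMap.

Arguments ker_map {K V V' W W' g g' f} fP.

Section QuotMap.
Context (K : fieldType) (V W : lmodType K).
Context (S : submodClosed V) (T : submodClosed W) (f : {linear V -> W}).

(* The proof argument only serves to infer the linear structure below. *)
Definition quot_map of {homo f : x / x \in S >-> x \in T} :=
  fun u : quot_space S =>
    quot_proj T (f (repr (u : Quotient.quot (subspace_pred S)))).

Hypothesis fST : {homo f : x / x \in S >-> x \in T}.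

(** Independence of the representative: the chosen one differs from [x] by an element of [S], and
    [f] sends that difference into [T]. *)
Lemma quot_mapE x : quot_map fST (quot_proj S x) = quot_proj T (f x).
Proof.
apply/quot_projP; rewrite -raddfB; apply/fST/quot_projP.
by rewrite /quot_proj reprK.
Qed.

Lemma quot_map_linear : linear (quot_map fST).
Proof.
move=> a u v; have [x <-] := quot_proj_surj u; have [y <-] := quot_proj_surj v.
by rewrite -linearP !quot_mapE !linearP.
Qed.

HB.instance Definition _ := GRing.isLinear.Build K (quot_space S) (quot_space T)
  *:%R (quot_map fST) quot_map_linear.

End QuotMap.

Arguments quot_map {K V W S T f} fST.

Section CohomologyMap.
Context (K : fieldType) (X Y : int -> lmodType K).
Context (d : forall i, {linear X i -> X (i + 1)}).
Context (e : forall i, {linear Y i -> Y (i + 1)}).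
Context (f : forall i, {linear X i -> Y i}).
Hypothesis fd : forall i x, f (i + 1) (d i x) = e i (f i x).

(* The target index [k] is kept free so that the cast can be eliminated. *)
Lemma ecast_diff_morph (j k : int) (p : j + 1 = k) x :
  f k (ecast l {linear X j -> X l} p (d j) x) =
  ecast l {linear Y j -> Y l} p (e j) (f j x).
Proof. by case: k / p; exact: fd. Qed.

Lemma dprev_morph i x : f i (dprev d i x) = dprev e i (f (i - 1) x).
Proof. exact: ecast_diff_morph. Qed.

Lemma cocycle_morph i x : d i x = 0 -> e i (f i x) = 0.
Proof. by move=> dx; rewrite -fd dx raddf0. Qed.

Lemma coboundary_morph i x :
  x \in im_in_ker (dprev d i) (d i) ->
  ker_map (@cocycle_morph i) x \in im_in_ker (dprev e i) (e i).
Proof.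
(* A primitive of the coboundary is carried along by [f] one degree lower. *)
move=> /asboolP[y yx]; apply/asboolP; exists (f (i - 1) y).
by rewrite -dprev_morph yx.
Qed.

Definition cohomology_map i : {linear cohomology d i -> cohomology e i} :=
  quot_map (@coboundary_morph i).

Lemma cohomology_mapE i x :
  cohomology_map i (quot_proj _ x) = quot_proj _ (ker_map (@cocycle_morph i) x).
Proof. exact: quot_mapE. Qed.

End CohomologyMap.

Arguments cohomology_map {K X Y d e f} fd i.
Arguments cohomology_mapE {K X Y d e f} fd i x.

(** Passing to classes kills coboundaries, so a one-sided inverse on cohomology only requires
    [g \o f] to fix cocycles up to a coboundary. Applied in both directions, it gives the two halves
    of bijectivity. *)
Lemma cohomology_mapK (K : fieldType) (X Y : int -> lmodType K)
    (d : forall i, {linear X i -> X (i + 1)})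
    (e : forall i, {linear Y i -> Y (i + 1)})
    (f : forall i, {linear X i -> Y i}) (g : forall i, {linear Y i -> X i})
    (fd : forall i x, f (i + 1) (d i x) = e i (f i x))
    (ge : forall i y, g (i + 1) (e i y) = d i (g i y)) (i : int) :
  (forall x, d i x = 0 -> exists y, g i (f i x) - x = dprev d i y) ->
  cancel (cohomology_map fd i) (cohomology_map ge i).
Proof.
move=> gf u; have [x <-] := quot_proj_surj u; rewrite !cohomology_mapE.
have [y yE] := gf _ (ker_valK x).
by apply/quot_projP/asboolP; exists y.
Qed.

Lemma lin_isomorphic_trivial (K : fieldType) (U V : lmodType K) :
  lin_isomorphic U V -> (forall u : U, u = 0) <-> (forall v : V, v = 0).
Proof.
move=> [f [g fK gK]]; split=> [U0 v | V0 u].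
  by rewrite -(gK v) (U0 (g v)) raddf0.
by apply: (can_inj fK); rewrite !(V0 (f _)).
Qed.

Theorem proposition2 (K : fieldType) (X Xh : int -> lmodType K)
  (d : forall i : int, {linear X i -> X (i + 1)})
  (E : forall i : int, {linear Xh i -> X i})
  (Rh : forall i : int, {linear X i -> Xh i})
  (d_complex : is_complex d)
  (C1 : forall (i : int) (x : Xh i), dhat d E Rh i x = 0 -> Rh i (E i x) = x)
  (C2 : forall (i : int) (x : X (i + 1)), d (i + 1) x = 0 ->
     exists y : X i, E (i + 1) (Rh (i + 1) x) - x = d i y)
  (C3 : forall i : int,
     (forall x : X i, Rh (i + 1) (d i x) = dhat d E Rh i (Rh i x)) /\
     (forall x : Xh i, E (i + 1) (dhat d E Rh i x) = d i (E i x))) :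
  [/\ is_complex (dhat d E Rh),
      isomorphic_cohomologies d (dhat d E Rh)
    & is_exact d <-> is_exact (dhat d E Rh)].
Proof.
have Rd i x : Rh (i + 1) (d i x) = dhat d E Rh i (Rh i x) by case: (C3 i).
have Ed i x : E (i + 1) (dhat d E Rh i x) = d i (E i x) by case: (C3 i).
(* (C2) concerns degree [i + 1], whereas cohomology in degree [i] involves [dprev], a cast of
   [d (i - 1)]. With both indices free, eliminating [p] removes the cast; taking [p := subrK 1 i]
   then yields the statement about [dprev]. *)
have C2' (j i : int) (p : j + 1 = i) (x : X i) : d i x = 0 ->
    exists y, E i (Rh i x) - x = ecast k {linear X j -> X k} p (d j) y.
  by case: i / p x => x; exact: C2.
have iso : isomorphic_cohomologies d (dhat d E Rh).
  move=> i; exists (cohomology_map Rd i); exists (cohomology_map Ed i).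
    by apply: cohomology_mapK => x; exact: C2'.
  (* By (C1) the difference is exactly zero on cocycles, hence the coboundary of 0. *)
  apply: cohomology_mapK => x /C1 ->.
  by exists 0; rewrite subrr raddf0.
split=> //.
  (* Only the outer [dhat] is unfolded: its [E] moves past the inner one by (C3), which makes two
     consecutive [d] appear. *)
  by move=> i x; rewrite {1}/dhat /= Ed d_complex raddf0.
split=> ex i; exact/(lin_isomorphic_trivial (iso i))/ex.
Qed.
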